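(* Let $\mathbf{r}=(r_1,\dots,r_n)$ be a sequence of integers with $1\le r_1\le r_2\le\cdots\le r_n\le n$ and $r_k\ge k$ for all $k$. The triples $(\mathrm{inv},\mathrm{Rlminl},\mathrm{Lrmaxp})$ and $(\mathrm{sor},\mathrm{Cyc},\mathrm{Lrmaxp})$ are equidistributed on $S_{\mathbf r}$. That is, the multisets \[ \{(\mathrm{inv}(\sigma),\mathrm{Rlminl}(\sigma),\mathrm{Lrmaxp}(\sigma)):\sigma\in S_{\mathbf r}\}\quad\text{and}\quad \{(\mathrm{sor}(\sigma),\mathrm{Cyc}(\sigma),\mathrm{Lrmaxp}(\sigma)):\sigma\in S_{\mathbf r}\} \] are equal.
   Context: $S_{\mathbf r}=\{\sigma\in S_n:\sigma(k)\le r_k,\ 1\le k\le n\}$. For $\sigma\in S_n$: - $\mathrm{inv}(\sigma)$ is the number of pairs $i<j$ with $\sigma(i)>\sigma(j)$. - $\mathrm{Rlminl}(\sigma)$ (right-to-left minimum letters) is the set of values $\sigma(i)$ such that $\sigma(i)<\sigma(j)$ for all $j>i$. - $\mathrm{Lrmaxp}(\sigma)=\{k:\sigma(k)>\sigma(j)\text{ for all }j<k\}$ (left-to-right maximum places). - $\mathrm{Cyc}(\sigma)$ is the set of minimal elements of the cycles of $\sigma$ (fixed points included as cycles). - $\mathrm{sor}(\sigma)$ is the sorting index: $\sigma$ has a unique expression $\sigma=(i_1\,j_1)(i_2\,j_2)\cdots(i_k\,j_k)$ as a product of transpositions with $i_s<j_s$ for all $s$ and $j_1<\cdots<j_k$ (products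 are composed as functions, right to left), and $\mathrm{sor}(\sigma)=\sum_{s=1}^k(j_s-i_s)$. *)

(* Defs.v *)
From mathcomp Require Import all_boot all_fingroup.

Set Implicit Arguments.
Unset Strict Implicit.
Unset Printing Implicit Defensive.

(* Positions and letters 1..n are represented by the ordinals 0..n-1 of 'I_n,
   so the letter sigma(k) is (s k).+1; the bounds r_k keep their values. *)

Definition restricted_perms n (r : 'I_n -> nat) : {set 'S_n} :=
  [set s : 'S_n | [forall k : 'I_n, (s k).+1 <= r k]].

Definition invnum n (s : 'S_n) : nat :=
  #|[set p : 'I_n * 'I_n | (p.1 < p.2) && (s p.1 > s p.2)]|.

Definition Rlminl n (s : 'S_n) : {set 'I_n} :=
  [set s i | i : 'I_n & [forall j : 'I_n, (i < j) ==> (s i < s j)]].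

Definition Lrmaxp n (s : 'S_n) : {set 'I_n} :=
  [set k : 'I_n | [forall j : 'I_n, (j < k) ==> (s k > s j)]].

Definition Cyc n (s : 'S_n) : {set 'I_n} :=
  [set i : 'I_n | [exists C in porbits s,
                     (i \in C) && [forall j in C, i <= j]]].

(* The product (i_1 j_1) ... (i_k j_k) composed right to left. In MathComp
   (s * t) x = t (s x), hence the reversal. *)
Definition transp_prod n (w : seq ('I_n * 'I_n)) : 'S_n :=
  (\prod_(p <- rev w) tperm p.1 p.2)%g.

Definition sorting_word n (s : 'S_n) (w : seq ('I_n * 'I_n)) : bool :=
  [&& all (fun p : 'I_n * 'I_n => p.1 < p.2) w,
      sorted (fun p q : 'I_n * 'I_n => p.2 < q.2) w
    & transp_prod w == s].

Lemma transp_prod_nil n : transp_prod [::] = 1%g :> 'S_n.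
Proof. by rewrite /transp_prod big_nil. Qed.

Lemma transp_prod_rcons n (w : seq ('I_n * 'I_n)) (p : 'I_n * 'I_n) :
  transp_prod (rcons w p) = (tperm p.1 p.2 * transp_prod w)%g.
Proof. by rewrite /transp_prod rev_rcons big_cons. Qed.

Lemma transp_prod_cons n (w : seq ('I_n * 'I_n)) p x :
  transp_prod (p :: w) x = tperm p.1 p.2 (transp_prod w x).
Proof. by rewrite /transp_prod rev_cons -cats1 big_cat big_seq1 permM. Qed.

Lemma sorted_rcons_snd n (w : seq ('I_n * 'I_n)) (p : 'I_n * 'I_n) :
  sorted (fun p q : 'I_n * 'I_n => p.2 < q.2) (rcons w p) =
  sorted (fun p q : 'I_n * 'I_n => p.2 < q.2) w
    && all (fun q : 'I_n * 'I_n => q.2 < p.2) w.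
Proof.
have tr : transitive (fun p q : 'I_n * 'I_n => p.2 < q.2).
  by move=> y x z; apply: ltn_trans.
by rewrite !sorted_pairwise // pairwise_rcons andbC.
Qed.

Lemma sorting_word_exists n (s : 'S_n) : exists w, sorting_word s w.
Proof.
suff H m : forall s : 'S_n, (forall k : 'I_n, m <= k -> s k = k) ->
    exists2 w, sorting_word s w & all (fun q : 'I_n * 'I_n => q.2 < m) w.
  have [|w Hw _] := H n s; last by exists w.
  by move=> k; rewrite leqNgt ltn_ord.
elim: m => [|m IHm] {}s fix_s.
  exists [::] => //; rewrite /sorting_word /= transp_prod_nil eq_sym.
  by apply/eqP/permP=> k; rewrite perm1 fix_s.
case: (ltnP m n) => [lt_mn|le_nm]; last first.
  have [|w Hw w_lt] := IHm s; first by move=> k /(leq_trans le_nm); rewrite leqNgt ltn_ord.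
  by exists w => //; apply: sub_all w_lt => q /= /leqW.
pose M := Ordinal lt_mn; pose i := (s^-1)%g M.
have si : s i = M by rewrite permKV.
have [|w /and3P[w_lt w_sorted /eqP w_s] w_m] := IHm (tperm i M * s)%g.
  move=> k; rewrite leq_eqVlt => /orP[/eqP eq_k|lt_mk].
    have ->: k = M by apply: val_inj.
    by rewrite permM tpermR.
  have sk := fix_s k lt_mk.
  have neqMk : M != k by rewrite -val_eqE /= neq_ltn lt_mk.
  have neqik : i != k by apply: contraNneq neqMk => ik; rewrite -si ik sk.
  by rewrite permM tpermD.
have [iM|neqiM] := eqVneq i M.
  exists w; last by apply: sub_all w_m => q /= /leqW.
  by rewrite /sorting_word w_lt w_sorted w_s iM tperm1 mul1g eqxx.
have lt_iM : i < M.
  rewrite ltnNge; apply: contra neqiM => le_Mi.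
  move: le_Mi; rewrite leq_eqVlt => /orP[/eqP eqMi|lt_Mi].
    by apply/eqP/val_inj.
  by rewrite -[X in X == _](fix_s i lt_Mi) si.
exists (rcons w (i, M)).
  rewrite /sorting_word all_rcons w_lt lt_iM sorted_rcons_snd w_sorted /= w_m.
  by rewrite transp_prod_rcons w_s /= mulgA tperm2 mul1g eqxx.
by rewrite all_rcons /= ltnSn; apply: sub_all w_m => q /= /leqW.
Qed.

Lemma transp_prod_fix n (w : seq ('I_n * 'I_n)) (k : 'I_n) :
  all (fun p : 'I_n * 'I_n => p.1 < p.2) w ->
  all (fun q : 'I_n * 'I_n => q.2 < k) w -> transp_prod w k = k.
Proof.
elim: w => [|[a b] w IHw] /=; first by rewrite transp_prod_nil perm1.
move=> /andP[lt_ab w_lt] /andP[lt_bk w_k].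
rewrite transp_prod_cons IHw //= tpermD // -val_eqE neq_ltn ?lt_bk //.
by rewrite (ltn_trans lt_ab lt_bk).
Qed.

Lemma sorting_word_unique n (s : 'S_n) w1 w2 :
  sorting_word s w1 -> sorting_word s w2 -> w1 = w2.
Proof.
(* The last transposition (i, j) of a word is determined by its product: j is
   the largest moved point and i is its preimage. *)
have last_fix (w : seq ('I_n * 'I_n)) (p : 'I_n * 'I_n) (k : 'I_n) : p.1 < p.2 ->
    all (fun p : 'I_n * 'I_n => p.1 < p.2) w ->
    all (fun q : 'I_n * 'I_n => q.2 < p.2) w -> p.2 < k ->
    transp_prod (rcons w p) k = k.
  move=> lt_p w_lt w_p lt_k; apply: transp_prod_fix.
    by rewrite all_rcons lt_p.
  by rewrite all_rcons lt_k; apply: sub_all w_p => q /= /ltn_trans; apply.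
have last_img (w : seq ('I_n * 'I_n)) (p : 'I_n * 'I_n) :
    all (fun p : 'I_n * 'I_n => p.1 < p.2) w ->
    all (fun q : 'I_n * 'I_n => q.2 < p.2) w ->
    transp_prod (rcons w p) p.1 = p.2.
  by move=> *; rewrite transp_prod_rcons permM tpermL transp_prod_fix.
have last_neq1 (w : seq ('I_n * 'I_n)) (p : 'I_n * 'I_n) : p.1 < p.2 ->
    all (fun p : 'I_n * 'I_n => p.1 < p.2) w ->
    all (fun q : 'I_n * 'I_n => q.2 < p.2) w ->
    transp_prod (rcons w p) != 1%g.
  move=> lt_p w_lt w_p; apply/eqP=> eq1; have := last_img w p w_lt w_p.
  by rewrite eq1 perm1 => eqp; rewrite eqp ltnn in lt_p.
elim/last_ind: w1 s w2 => [|w1 p IH] s w2.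
  move=> /and3P[_ _ /eqP <-]; case/lastP: w2 => // w2 p /and3P[].
  rewrite all_rcons sorted_rcons_snd => /andP[lt_p w_lt] /andP[_ w_p].
  by rewrite transp_prod_nil (negPf (last_neq1 _ _ lt_p w_lt w_p)).
move=> /and3P[]; rewrite all_rcons sorted_rcons_snd.
move=> /andP[lt_p w1_lt] /andP[w1_s w1_p] /eqP eq1.
case/lastP: w2 => [|w2 q] /and3P[].
  move=> _ _; rewrite transp_prod_nil -eq1 eq_sym.
  by rewrite (negPf (last_neq1 _ _ lt_p w1_lt w1_p)).
rewrite all_rcons sorted_rcons_snd.
move=> /andP[lt_q w2_lt] /andP[w2_s w2_q] /eqP eq2.
have im1 := last_img _ _ w1_lt w1_p; have im2 := last_img _ _ w2_lt w2_q.
rewrite eq1 in im1; rewrite eq2 in im2.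
have e2 : p.2 = q.2.
  case: (ltngtP p.2 q.2) => [lt|lt|/val_inj //].
    have := last_fix _ _ _ lt_p w1_lt w1_p lt; rewrite eq1 -[in RHS]im2.
    by move/perm_inj=> e; rewrite e ltnn in lt_q.
  have := last_fix _ _ _ lt_q w2_lt w2_q lt; rewrite eq2 -[in RHS]im1.
  by move/perm_inj=> e; rewrite e ltnn in lt_p.
have e1 : p.1 = q.1 by apply: (@perm_inj _ s); rewrite im1 im2.
have epq : p = q by rewrite (surjective_pairing p) e1 e2 -surjective_pairing.
rewrite -epq in eq2 w2_q *; congr rcons.
apply: (IH (transp_prod w1)); first by rewrite /sorting_word w1_lt w1_s eqxx.
rewrite /sorting_word w2_lt w2_s /=; apply/eqP/(mulgI (tperm p.1 p.2)).
by rewrite -!transp_prod_rcons eq1 eq2.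
Qed.

Definition sor n (s : 'S_n) : nat :=
  \sum_(p <- xchoose (sorting_word_exists s)) (p.2 - p.1).

Lemma sorE n (s : 'S_n) w :
  sorting_word s w -> sor s = \sum_(p <- w) (p.2 - p.1).
Proof.
by move=> sw; rewrite /sor (sorting_word_unique (xchooseP _) sw).
Qed.

(* Main.v *)
(* Build a permutation of 1..m by placing the letter m at some place i <= m of
   a permutation s' of 1..m-1, in one of two ways: insert m at place i and
   shift the later letters to the right, or put m at place i and move the
   letter displaced to place m.  The first way adds m - i to inv, the second
   adds m - i to sor; m enters Rlminl, respectively Cyc, iff i = m, and the
   rest of these sets is unchanged; both ways keep the left-to-right maximum
   places of s' before i and add i.  Since r is nondecreasing, in both cases
   the result lies in S_r iff s' does and m <= r_i.  Hence iterating
   "remove m by un-inserting, put it back by swapping" is the bijection. *)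
Require Import Defs.
From mathcomp Require Import all_boot all_fingroup.
From mathcomp Require Import zify.

Set Implicit Arguments.
Unset Strict Implicit.
Unset Printing Implicit Defensive.

(** * Placing a largest letter: what both constructions share *)

(** Encodes a permutation of the first [m] letters inside ['S_n], so that an induction on [m] stays
    in one type. *)
Definition fixes_from n m (s : 'S_n) := forall k : 'I_n, m <= k -> s k = k.

Lemma fixes_from_lt n m (s : 'S_n) (k : 'I_n) :
  fixes_from m s -> k < m -> s k < m.
Proof.
move=> fix_s lt_km; rewrite ltnNge; apply/negP=> le_msk.
by have /perm_inj sk := fix_s _ le_msk; move: le_msk; rewrite sk leqNgt lt_km.
Qed.

Lemma fixes_fromW n m (s : 'S_n) : fixes_from m s -> fixes_from m.+1 s.
Proof. by move=> fix_s k /ltnW /fix_s. Qed.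

Lemma fixes_from_le n (M : 'I_n) (s : 'S_n) (k : 'I_n) :
  fixes_from M.+1 s -> k <= M -> s k <= M.
Proof. by move=> fix_s le_kM; apply: fixes_from_lt fix_s _. Qed.

(** The common ground of insertion and swapping: nothing ties [s] to [s'] at the places after [i] up
    to [M], where the two constructions differ. *)
Definition places_max n (M i : 'I_n) (s' s : 'S_n) :=
  [/\ fixes_from M s', fixes_from M.+1 s, i <= M, s i = M
    & forall k : 'I_n, k < i -> s k = s' k].

(** Places after [i] up to [M] are dominated by the letter [M] at [i]; places beyond [M] are fixed
    and exceed all earlier letters. *)
Lemma Lrmaxp_places_max n (M i : 'I_n) (s' s : 'S_n) :
  places_max M i s' s ->
  Lrmaxp s = [set k : 'I_n | [|| (k < i) && (k \in Lrmaxp s'), k == i | M < k]].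
Proof.
case=> fix_s' fix_s le_iM si eq_s; apply/setP=> k; rewrite !inE.
case: (ltngtP k i) => [lt_ki|lt_ik|/val_inj ->] /=.
- have -> : (k == i) = false by rewrite -val_eqE /=; lia.
  have -> : (M < k) = false by lia.
  rewrite !orbF; apply: eq_forallb => j; apply: implyb_id2l => lt_jk.
  by rewrite !eq_s // (ltn_trans lt_jk).
- have -> : (k == i) = false by rewrite -val_eqE /=; lia.
  case: (ltnP M k) => [lt_Mk|le_kM] /=.
    apply/forallP=> j; apply/implyP=> lt_jk; rewrite (fix_s k) //.
    case: (leqP j M) => [le_jM|lt_Mj]; last by rewrite fix_s.
    by apply: leq_ltn_trans lt_Mk; apply: fixes_from_le.
  apply/negP=> /forallP/(_ i); rewrite lt_ik si /= ltnNge.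
  by rewrite fixes_from_le.
rewrite eqxx; apply/forallP=> j; apply/implyP=> lt_ji.
by rewrite si eq_s //; apply: fixes_from_lt fix_s' _; lia.
Qed.

(** At a place [k] from [i] to [M] the letter is at most [M], and [M < r i <= r k]; so beyond
    [M < r i] only the letters before [i], common to [s] and [s'], matter. *)
Lemma restricted_perms_places_max n (r : 'I_n -> nat) (M i : 'I_n)
    (s' s : 'S_n) :
  (forall i j : 'I_n, i <= j -> r i <= r j) ->
  (forall k : 'I_n, k.+1 <= r k) ->
  places_max M i s' s ->
  (s \in restricted_perms r) = (M < r i) && (s' \in restricted_perms r).
Proof.
move=> r_mono r_ge [fix_s' fix_s le_iM si eq_s]; rewrite !inE.
have bnd (t : 'S_n) (k : 'I_n) : fixes_from M.+1 t -> M < r i -> i <= k ->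
    t k < r k.
  move=> fix_t lt_Mr le_ik; case: (leqP k M) => [le_kM|/fix_t -> //].
  apply: leq_ltn_trans (leq_trans lt_Mr (r_mono _ _ le_ik)).
  exact: fixes_from_le.
apply/forallP/andP=> [r_s | [lt_Mr /forallP r_s'] k].
  have lt_Mr : M < r i by have := r_s i; rewrite si.
  split=> //; apply/forallP=> k; case: (ltnP k i) => [lt_ki|le_ik].
    by rewrite -eq_s.
  exact: bnd (fixes_fromW fix_s') _ _.
case: (ltnP k i) => [/eq_s -> //|]; exact: bnd.
Qed.

(** * Insertion of the largest letter: inversions and right-to-left minima *)

(** Sends each place after the insertion to the place its letter came from: a cycle on [i..M]. The
    default [x] of [insubd] is never taken, all values being below [n]. *)
Definition remove_place_fun n (i M x : 'I_n) : 'I_n :=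
  insubd x (if x == i then M : nat else if i < x <= M then x.-1 else x).

Lemma val_remove_place_fun n (i M x : 'I_n) :
  remove_place_fun i M x =
    (if x == i then M : nat else if i < x <= M then x.-1 else x) :> nat.
Proof.
rewrite val_insubd ifT //.
by have := ltn_ord x; have := ltn_ord M; do ?case: ifP; lia.
Qed.

Lemma remove_place_fun_inj n (i M : 'I_n) :
  i <= M -> injective (remove_place_fun i M).
Proof.
move=> le_iM x y /(congr1 val); rewrite /= !val_remove_place_fun -!val_eqE /= => eq_xy.
by apply: val_inj => /=; move: eq_xy; do ?case: ifP; lia.
Qed.

Definition remove_place n (i M : 'I_n) (le_iM : i <= M) : 'S_n :=
  perm (remove_place_fun_inj le_iM).

Lemma card_interval_ord n (i M : 'I_n) :
  i <= M -> #|[set q : 'I_n | i < q <= M]| = M - i.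
Proof.
move=> le_iM; rewrite -subSS -[RHS]muln1 -sum_nat_const_nat.
rewrite (big_nat_widen _ _ n) // (@big_nat_widenl _ _ _ _ 0) // big_mkord.
by rewrite sum1_card; apply: eq_card => q; rewrite !inE andbC.
Qed.

Section RemovePlace.
Variables (n : nat) (i M : 'I_n) (le_iM : i <= M).
Let c := remove_place le_iM.

Lemma val_remove_place (x : 'I_n) :
  c x = (if x == i then M : nat else if i < x <= M then x.-1 else x) :> nat.
Proof. by rewrite permE val_remove_place_fun. Qed.

Lemma remove_place_max : c i = M.
Proof. by apply: val_inj; rewrite /= val_remove_place eqxx. Qed.

Lemma remove_place_lt (x : 'I_n) : x < i -> c x = x.
Proof.
by move=> lt_xi; apply: val_inj; rewrite /= val_remove_place -val_eqE /=; do ?case: ifP; lia.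
Qed.

Lemma remove_place_gt (x : 'I_n) : M < x -> c x = x.
Proof.
by move=> lt_xi; apply: val_inj; rewrite /= val_remove_place -val_eqE /=; do ?case: ifP; lia.
Qed.

Lemma ltn_remove_place (x y : 'I_n) :
  x != i -> y != i -> (c x < c y) = (x < y).
Proof.
move=> neq_xi neq_yi; rewrite !val_remove_place (negPf neq_xi) (negPf neq_yi).
by move: neq_xi neq_yi; rewrite -!val_eqE /=; do ?case: ifP; lia.
Qed.

Variables (s' : 'S_n) (fix_s' : fixes_from M s').
Let s := (c * s')%g.

Lemma places_max_insert : places_max M i s' s.
Proof.
split=> // [k lt_Mk||k lt_ki]; rewrite permM.
- by rewrite remove_place_gt // fix_s' // ltnW.
- by rewrite remove_place_max fix_s'.
by rewrite remove_place_lt.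
Qed.

(** Inversions starting at [i] are the pairs [(i, q)] with [i < q <= M]; the others match the
    inversions of [s'] under [cc]. *)
Lemma invnum_insert : invnum s = invnum s' + (M - i).
Proof.
have [_ fix_s _ si _] := places_max_insert.
pose cc (p : 'I_n * 'I_n) := (c p.1, c p.2).
have cc_inj : injective cc by move=> [a b] [d e] [/perm_inj -> /perm_inj ->].
rewrite /invnum -(cardsID [set p | p.1 == i]) addnC; congr (_ + _).
  rewrite -[RHS](card_preimset _ cc_inj); apply: eq_card => -[a b]; rewrite !inE /=.
  rewrite /s !permM.
  have [->|neq_ai] /= := eqVneq a i.
    apply/esym/andP=> -[]; rewrite remove_place_max => /ltnW le_Mb.
    by rewrite (fix_s' (leqnn _)) (fix_s' le_Mb); lia.
  (* A pair ending at [i] is an inversion on neither side: [s] at [i] and [s'] at [M] take the value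
     [M], above every letter to the left. *)
  have [->|neq_bi] := eqVneq b i; last by rewrite ltn_remove_place.
  rewrite remove_place_max (fix_s' (leqnn _)).
  suff no_inv : (c a < M) || (a < i) -> ~~ (M < s' (c a)).
    apply/andP/andP=> -[lt1 lt2].
      by rewrite lt1 orbT lt2 in no_inv; have := no_inv isT.
    by rewrite lt1 lt2 in no_inv; have := no_inv isT.
  move=> lt_a; rewrite -leqNgt ltnW // (fixes_from_lt fix_s') //.
  by case/orP: lt_a => // lt_ai; rewrite remove_place_lt // (leq_trans lt_ai).
rewrite -(card_interval_ord le_iM) -[RHS](card_imset _ (can_inj (g := snd) (f := pair i) _)) //.
apply: eq_card => -[a b]; rewrite !inE /=; apply/idP/imsetP.
  case/andP=> /andP[lt_ab lt_s] /eqP eq_ai; subst a; exists b => //.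
  rewrite !inE lt_ab /= leqNgt; apply/negP=> lt_Mb.
  by move: lt_s; rewrite si (fix_s b) // ltnNge ltnW.
case=> q; rewrite !inE => /andP[lt_iq le_qM] [-> ->].
rewrite eqxx lt_iq si andbT ltn_neqAle fixes_from_le // andbT.
apply/eqP=> /val_inj; rewrite -si => /perm_inj eq_q.
by rewrite eq_q ltnn in lt_iq.
Qed.

(** The letter [M] could block only larger letters, and these sit to its right; so only the status
    of [M] itself can change. If [i < M], place [M] holds a smaller letter to its right. *)
Lemma Rlminl_insert :
  Rlminl s = [set x in Rlminl s' | (x != M) || (i == M)].
Proof.
have [_ fix_s _ si _] := places_max_insert.
have Rl (t : 'S_n) a :
    (t a \in Rlminl t) = [forall j : 'I_n, (a < j) ==> (t a < t j)].
  by rewrite (mem_imset _ _ perm_inj) inE.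
apply/setP=> x; rewrite inE -(permKV s x); move: (_ x) => {x} a.
rewrite Rl /s permM Rl.
have [->|neq_ai] := eqVneq a i.
  rewrite remove_place_max (fix_s' (leqnn _)) eqxx /=.
  have [eq_iM|neq_iM] := eqVneq i M; last first.
    rewrite andbF; apply/forallP=> /(_ M); rewrite ltn_neqAle neq_iM le_iM /=.
    by rewrite ltnNge fixes_from_le.
  rewrite andbT; apply/forallP/forallP=> H j; apply/implyP=> lt_j.
    by rewrite fix_s' // ltnW.
  by rewrite fix_s // -eq_iM.
have -> : s' (c a) != M.
  rewrite -(fix_s' (leqnn _)) -remove_place_max.
  by apply: contra neq_ai => /eqP/perm_inj/perm_inj ->.
rewrite andbT; apply/forallP/forallP=> H j; last first.
  have [->|neq_ji] := eqVneq j i.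
    apply/implyP=> lt_ai; rewrite si.
    by apply: fixes_from_lt => //; rewrite remove_place_lt //; lia.
  by have := H (c j); rewrite permM ltn_remove_place.
have [j' ->] : exists j', j = c j' by exists ((c^-1)%g j); rewrite permKV.
have [->|neq_ji] := eqVneq j' i; last first.
  by have := H j'; rewrite permM ltn_remove_place.
rewrite remove_place_max (fix_s' (leqnn _)); apply/implyP.
exact: fixes_from_lt.
Qed.
End RemovePlace.

(** * Swapping the largest letter in: sorting index and cycle minima *)

(** The last transposition has the largest second entry, and [s] sends its first entry there; so
    that second entry is not fixed and lies below [m]. *)
Lemma fixes_from_sorting_word n m (s : 'S_n) w :
  fixes_from m s -> sorting_word s w -> all (fun q : 'I_n * 'I_n => q.2 < m) w.
Proof.
case/lastP: w => // w p fix_s /and3P[].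
rewrite !all_rcons sorted_rcons_snd => /andP[lt_p w_lt] /andP[_ w_p] /eqP w_s.
have sp : s p.1 = p.2.
  by rewrite -w_s transp_prod_rcons permM tpermL transp_prod_fix.
have lt_pm : p.2 < m.
  rewrite ltnNge; apply/negP=> /fix_s; rewrite -[in RHS]sp => /perm_inj eq_p.
  by rewrite eq_p ltnn in lt_p.
by rewrite lt_pm; apply: sub_all w_p => q /= /ltn_trans; apply.
Qed.

Lemma in_Cyc n (s : 'S_n) x :
  (x \in Cyc s) = [forall j in porbit s x, x <= j].
Proof.
rewrite inE; apply/exists_inP/idP=> [[_ /imsetP[y _ ->]] | le_x].
  by rewrite -eq_porbit_mem => /andP[/eqP-> ].
by exists (porbit s x); rewrite ?imset_f // porbit_id.
Qed.

Lemma porbit_closed n (s : 'S_n) (A : {pred 'I_n}) x y :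
  (forall z, z \in A -> s z \in A) -> x \in A -> y \in porbit s x -> y \in A.
Proof.
move=> closedA Ax /porbitP[k ->]; elim: k => [|k IHk]; first by rewrite perm1.
by rewrite expgSr permM closedA.
Qed.

Lemma porbit_step n (s : 'S_n) x y : y \in porbit s x -> s y \in porbit s x.
Proof.
rewrite -(eq_porbit_mem s y) => /eqP <-; exact: (mem_porbit s 1).
Qed.

Lemma porbit_fix n (s : 'S_n) x y : s x = x -> y \in porbit s x -> y = x.
Proof.
move=> sx; move/(@porbit_closed _ s (pred1 x)) => H; apply/eqP/H => [z|].
  by rewrite !inE => /eqP ->; rewrite sx.
by rewrite inE.
Qed.

Section SwapPlace.
Variables (n : nat) (i M : 'I_n) (le_iM : i <= M).
Variables (s' : 'S_n) (fix_s' : fixes_from M s').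
Let s := (tperm i M * s')%g.

Lemma places_max_swap : places_max M i s' s.
Proof.
split=> // [k lt_Mk||k lt_ki]; rewrite permM.
- by rewrite tpermD ?fix_s' // 1?ltnW // -val_eqE /=; lia.
- by rewrite tpermL fix_s'.
by rewrite tpermD // -val_eqE /=; lia.
Qed.

(** All second entries in the word of [s'] are below [M], so appending [(i, M)] gives the word of
    [s]; for [i = M] the word is unchanged. *)
Lemma sor_swap : sor s = sor s' + (M - i).
Proof.
have [w sw] := sorting_word_exists s'.
have w_M := fixes_from_sorting_word fix_s' sw; have /and3P[w_lt w_s /eqP eq_s'] := sw.
have [eq_iM|neq_iM] := eqVneq i M.
  by rewrite /s eq_iM tperm1 mul1g subnn addn0.
rewrite (@sorE _ s (rcons w (i, M))); first by rewrite big_rcons /= (sorE sw).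
rewrite /sorting_word all_rcons sorted_rcons_snd w_lt w_s w_M.
by rewrite transp_prod_rcons eq_s' eqxx ltn_neqAle neq_iM le_iM.
Qed.

(** For [i < M], the swap inserts [M] just after [i] in the cycle of [i] and leaves the other
    elements in their cycles. *)
Lemma mem_porbit_swap x y :
  x != M -> y != M -> (y \in porbit s x) = (y \in porbit s' x).
Proof.
move=> neq_xM neq_yM; have s'M : s' M = M by apply: fix_s'.
(* Contracting [M] to [i] turns each step of [s] into a step of [s'] or a pause. *)
pose f z := if z == M then i else z.
have [eq_iM|neq_iM] := eqVneq i M; first by rewrite /s eq_iM tperm1 mul1g.
apply/idP/idP => yx.
  suff : y \in [pred z | f z \in porbit s' x] by rewrite inE /f (negPf neq_yM).
  apply: porbit_closed yx; last by rewrite inE /f (negPf neq_xM) porbit_id.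
  move=> z; rewrite !inE /f /s permM.
  have [->|neq_zM] := eqVneq z M.
    rewrite tpermR -s'M (inj_eq perm_inj) (negPf neq_iM).
    exact: porbit_step.
  have [->|neq_zi] := eqVneq z i; first by rewrite tpermL s'M eqxx.
  rewrite tpermD 1?eq_sym // -s'M (inj_eq perm_inj) eq_sym (negPf neq_zM).
  exact: porbit_step.
suff /andP[] : y \in [pred z | (z != M) && (z \in porbit s x)] by [].
apply: porbit_closed yx; last by rewrite inE neq_xM porbit_id.
move=> z; rewrite !inE => /andP[neq_zM zx].
rewrite -{1}s'M (inj_eq perm_inj) neq_zM /=.
have [eq_zi|neq_zi] := eqVneq z i; last first.
  by rewrite -[z](@tpermD _ i M) 1?eq_sym // -permM porbit_step.
(* From [i], one step of [s'] is two steps of [s], through [M]. *)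
have <- : s (s z) = s' z by rewrite /s eq_zi !permM tpermL s'M tpermR.
by do 2!apply: porbit_step.
Qed.

(** Joining the cycle of a smaller [i], [M] is not its minimum and cannot displace it, since only
    elements up to [M] are moved. *)
Lemma Cyc_swap : Cyc s = [set x in Cyc s' | (x != M) || (i == M)].
Proof.
apply/setP=> x; rewrite inE !in_Cyc.
have [eq_iM|neq_iM] := eqVneq i M.
  by rewrite /s eq_iM tperm1 mul1g orbT andbT.
rewrite orbF; have [->|neq_xM] := eqVneq x M.
  rewrite andbF; apply/forall_inP=> /(_ i); rewrite porbit_sym.
  have [_ _ _ <- _] := places_max_swap; rewrite porbit_step ?porbit_id //.
  move=> /(_ isT); have [_ _ _ -> _] := places_max_swap.
  by rewrite leqNgt ltn_neqAle neq_iM le_iM.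
rewrite andbT; case: (ltngtP x M) => [lt_xM|lt_Mx|/val_inj/eqP]; last first.
- by rewrite (negPf neq_xM).
- have [_ fix_s _ _ _] := places_max_swap.
  apply/forall_inP/forall_inP=> _ y /porbit_fix -> //; last exact: fix_s.
  by apply: fix_s'; apply: ltnW.
apply/forall_inP/forall_inP=> le_x y; have [-> _|neq_yM] := eqVneq y M.
- exact: ltnW.
- by rewrite -mem_porbit_swap //; apply: le_x.
- exact: ltnW.
- by rewrite mem_porbit_swap //; apply: le_x.
Qed.
End SwapPlace.

(** * The bijection and the equidistribution *)

Lemma fixes_from0 n (s : 'S_n) : fixes_from 0 s -> s = 1%g.
Proof. by move=> fix_s; apply/permP=> k; rewrite perm1 fix_s. Qed.

Lemma perm1_stats n :
  (invnum (1 : 'S_n)%g, Rlminl (1 : 'S_n)%g) = (sor (1 : 'S_n)%g, Cyc (1 : 'S_n)%g).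
Proof.
have -> : sor (1 : 'S_n)%g = 0.
  rewrite (@sorE _ _ [::]) ?big_nil // /sorting_word /= transp_prod_nil.
  exact: eqxx.
congr pair.
  by apply/eq_card0=> -[a b]; rewrite !inE /= !perm1; apply/negP; lia.
have -> : Cyc (1 : 'S_n)%g = setT.
  apply/setP=> x; rewrite in_Cyc inE; apply/forall_inP=> y /porbit_fix -> //.
  by rewrite perm1.
apply/setP=> x; rewrite inE -[x](@perm1 'I_n) (mem_imset _ _ perm_inj) inE.
by apply/forallP=> j; apply/implyP; rewrite !perm1.
Qed.

(** The map is total on ['S_n] but controlled only on permutations fixing the places from [m] on. At
    [m = n], injectivity, finiteness and the equality of memberships make it a bijection of
    [restricted_perms r]. *)
Lemma ex_equidistributing_map n (r : 'I_n -> nat) m :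
  (forall i j : 'I_n, i <= j -> r i <= r j) ->
  (forall k : 'I_n, k.+1 <= r k) -> m <= n ->
  exists phi : 'S_n -> 'S_n,
    (forall s, fixes_from m s ->
      [/\ fixes_from m (phi s),
          (invnum s, Rlminl s, Lrmaxp s) =
            (sor (phi s), Cyc (phi s), Lrmaxp (phi s))
        & (phi s \in restricted_perms r) = (s \in restricted_perms r)])
    /\ (forall s t, fixes_from m s -> fixes_from m t ->
          phi s = phi t -> s = t).
Proof.
move=> r_mono r_ge; elim: m => [_|m IHm lt_mn].
  exists id; split=> // s fix_s; split=> //.
  by rewrite (fixes_from0 fix_s) perm1_stats.
have [phi [phiP phi_inj]] := IHm (ltnW lt_mn).
pose M := Ordinal lt_mn; pose place (s : 'S_n) := (s^-1)%g M.
have place_le s : fixes_from m.+1 s -> place s <= M.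
  move=> fix_s; rewrite leqNgt; apply/negP=> lt_M.
  have := fix_s _ lt_M; rewrite permKV => eq_M.
  by move: lt_M; rewrite -eq_M ltnn.
(* [remove_place] needs a proof of [place s <= M]; the filler [1] is never reached when [s]
   satisfies [fixes_from m.+1]. *)
pose removed (s : 'S_n) : 'S_n :=
  if decP (@idP (place s <= M)) is left le then ((remove_place le)^-1 * s)%g
  else 1%g.
have removedP s : fixes_from m.+1 s -> exists le : place s <= M,
    fixes_from M (removed s) /\ (remove_place le * removed s)%g = s.
  move=> fix_s; rewrite /removed; case: decP (place_le s fix_s) => // le _.
  exists le; split; last by rewrite mulKVg.
  move=> k /=; rewrite leq_eqVlt => /orP[/eqP eq_k|lt_mk].
    have -> : k = M by apply: val_inj.
    by rewrite permM (canLR (permK _) (esym (remove_place_max le))) permKV.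
  by rewrite permM (canLR (permK _) (esym (remove_place_gt le lt_mk))) fix_s.
exists (fun s => tperm (place s) M * phi (removed s))%g; split=> [s|s t].
  move=> /removedP[le [fix_s' eq_s]].
  have [fix_t' eq_stats mem_t'] := phiP _ fix_s'.
  have ins := places_max_insert le fix_s'; have swp := places_max_swap le fix_t'.
  split; first by case: swp.
    rewrite sor_swap // Cyc_swap // (Lrmaxp_places_max swp) -{1 2 3}eq_s.
    rewrite invnum_insert // Rlminl_insert // (Lrmaxp_places_max ins).
    by case: eq_stats => -> -> ->.
  rewrite (restricted_perms_places_max r_mono r_ge swp) mem_t' -[in RHS]eq_s.
  by rewrite (restricted_perms_places_max r_mono r_ge ins).
move=> /removedP[le_s [fix_s' eq_s]] /removedP[le_t [fix_t' eq_t]] eq_st.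
have [fix_phis _ _] := phiP _ fix_s'; have [fix_phit _ _] := phiP _ fix_t'.
(* The swap also leaves [M] at the chosen place, so the image reveals that place. *)
have eq_place : place s = place t.
  have [_ _ _ ps _] := places_max_swap le_s fix_phis.
  have [_ _ _ pt _] := places_max_swap le_t fix_phit.
  by move: pt; rewrite -eq_st -[in RHS]ps => /perm_inj.
move: eq_st; rewrite eq_place => /mulgI /(phi_inj _ _ fix_s' fix_t') eq_r.
rewrite -eq_s -eq_t eq_r; congr (_ * _)%g.
by apply/permP=> x; rewrite !permE eq_place.
Qed.

Theorem corollary2p12 (n : nat) (r : 'I_n -> nat)
  (r_bounds : forall k : 'I_n, 1 <= r k <= n)
  (r_mono : forall i j : 'I_n, i <= j -> r i <= r j)
  (r_ge : forall k : 'I_n, k.+1 <= r k) :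
  perm_eq [seq (invnum s, Rlminl s, Lrmaxp s) | s in restricted_perms r]
          [seq (sor s, Cyc s, Lrmaxp s) | s in restricted_perms r].
Proof.
have [phi [phiP phi_inj]] := ex_equidistributing_map r_mono r_ge (leqnn n).
have fixT (s : 'S_n) : fixes_from n s by move=> k; rewrite leqNgt ltn_ord.
have {}phi_inj : injective phi by move=> s t; apply: phi_inj.
(* Writes the first statistic as the second composed with [phi]; it remains that [phi] permutes the
   enumeration of [restricted_perms r]. *)
rewrite /image_mem (eq_map (g := (fun s => (sor s, Cyc s, Lrmaxp s)) \o phi)).
  rewrite map_comp; apply: perm_map; apply: uniq_perm; rewrite ?enum_uniq //.
    by rewrite map_inj_uniq ?enum_uniq.
  move=> s; rewrite mem_enum -[s](f_invF phi_inj) mem_map // mem_enum.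
  by have [_ _ ->] := phiP _ (fixT (invF phi_inj s)).
by move=> s /=; have [_ -> _] := phiP _ (fixT s).
Qed.
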